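(* Let $\mathcal{H}_M$ be a (real or complex) Hilbert space of finite dimension $M$, let $\{\varphi_i\}_{i=1}^N$ be a unit norm tight frame in $\mathcal{H}_M$, and assume $\sum_{i=1}^N\varphi_i=0$. Then $\sum_{i=1}^N\|x-\varphi_i\|^2=2N$ for every $x\in\mathcal{H}_M$ with $\|x\|=1$.
   Context: A family $\{\varphi_i\}_{i=1}^N$ in $\mathcal{H}_M$ is a tight frame if there is a constant $A>0$ with $\sum_{i=1}^N|\langle x,\varphi_i\rangle|^2=A\|x\|^2$ for all $x\in\mathcal{H}_M$; it is unit norm if $\|\varphi_i\|=1$ for all $i$. *)

(* Defs.v *)
From HB Require Import structures.
From mathcomp Require Import all_boot all_order all_algebra.
From mathcomp Require Import sesquilinear reals complex.

Set Implicit Arguments.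
Unset Strict Implicit.
Unset Printing Implicit Defensive.

Import Order.TTheory GRing.Theory Num.Theory.
Local Open Scope ring_scope.
Local Open Scope complex_scope.

Inductive scalar_kind := RealScalars | ComplexScalars.

Definition scalars (R : realType) (k : scalar_kind) : numFieldType :=
  match k with RealScalars => R | ComplexScalars => R[i] end.

Definition scalar_conj (R : realType) (k : scalar_kind) :
    scalars R k -> scalars R k :=
  match k with
  | RealScalars => @idfun R
  | ComplexScalars => @Num.conj R[i]
  end.

Definition scalar_re (R : realType) (k : scalar_kind) : scalars R k -> R :=
  match k with
  | RealScalars => @idfun R
  | ComplexScalars => @complex.Re R
  end.

(* The library norm `|z| lives in the scalar field itself (as a real element
   of R[i] in the complex case); scalar_re brings it back to R. *)
Definition scalar_abs (R : realType) (k : scalar_kind) (z : scalars R k) : R :=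
  scalar_re `|z|.

(* A finite-dimensional Hilbert space is a vectType V over the scalars with a
   positive definite hermitian form, linear in its first argument. As R is the
   field of real numbers, completeness is automatic. *)
Section Frames.
Variables (R : realType) (k : scalar_kind) (V : vectType (scalars R k)).
Variable (dot : {dot V for @scalar_conj R k}).

Definition hnorm (x : V) : R := Num.sqrt (scalar_re (dot x x)).

Definition tight_frame (N : nat) (phi : 'I_N -> V) : Prop :=
  exists A : R, 0 < A /\
    forall x : V, \sum_(i < N) scalar_abs (dot x (phi i)) ^+ 2
                  = A * hnorm x ^+ 2.

Definition unit_norm (N : nat) (phi : 'I_N -> V) : Prop :=
  forall i : 'I_N, hnorm (phi i) = 1.

End Frames.

(* Main.v *)
(* Expanding ||x - phi_i||^2 = 2 - Re <x, phi_i> - Re <phi_i, x>, the cross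
   terms sum to Re <x, sum phi_i> + Re <sum phi_i, x> = 0. *)

Require Import Defs.
From HB Require Import structures.
From mathcomp Require Import all_boot all_order all_algebra.
From mathcomp Require Import sesquilinear reals complex.
Import Order.TTheory GRing.Theory Num.Theory.

Local Open Scope ring_scope.

(** By [sqr_hnormB] each summand is 1 + 1 minus cross terms additive in [phi i]. Summed, these pair
    [x] with the zero vector, so each index contributes 2. Additivity of [scalar_re] lets it pass
    through the sum over either field. *)

Lemma scalar_re_is_zmod_morphism (R : realType) (k : scalar_kind) :
  zmod_morphism (@scalar_re R k).
Proof. by case: k => //= -[a b] [c d]. Qed.

HB.instance Definition _ (R : realType) (k : scalar_kind) :=
  GRing.isZmodMorphism.Build (scalars R k) R (@scalar_re R k)
    (scalar_re_is_zmod_morphism R k).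

Lemma scalar_re_ge0 (R : realType) (k : scalar_kind) (z : scalars R k) :
  0 <= z -> 0 <= scalar_re z.
Proof. by case: k z => //= -[a b]; rewrite lecE => /andP[]. Qed.

Section Dot.
Variables (R : realType) (k : scalar_kind) (V : vectType (scalars R k)).
Variable dot : {dot V for @scalar_conj R k}.

Lemma sqr_hnorm (x : V) : hnorm dot x ^+ 2 = scalar_re (dot x x).
Proof.
rewrite sqr_sqrtr //; apply: scalar_re_ge0.
(* Positive definiteness speaks only of nonzero vectors. *)
have [->|x0] := eqVneq x 0; first by rewrite linear0l.
by rewrite ltW // neq0_dnorm_gt0.
Qed.

(** Keeping the two cross terms apart, instead of merging them into twice a real part, requires only
    additivity in each argument, not hermitian symmetry. *)
Lemma sqr_hnormB (x y : V) :
  hnorm dot (x - y) ^+ 2 =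
  hnorm dot x ^+ 2 + hnorm dot y ^+ 2
  - (scalar_re (dot x y) + scalar_re (dot y x)).
Proof.
rewrite !sqr_hnorm linearBr /= !linearBl /= !raddfB /= opprK.
by rewrite [- _ + _]addrC addrACA -opprD [scalar_re (dot y x) + _]addrC.
Qed.

End Dot.

Theorem theorem6p7 (R : realType) (k : scalar_kind) (M : nat)
    (V : vectType (scalars R k)) (dimV : \dim {:V} = M)
    (dot : {dot V for @scalar_conj R k})
    (N : nat) (phi : 'I_N -> V) :
  unit_norm dot phi -> tight_frame dot phi -> \sum_(i < N) phi i = 0 ->
  forall x : V, hnorm dot x = 1 ->
    \sum_(i < N) hnorm dot (x - phi i) ^+ 2 = 2 * N%:R.
Proof.
move=> phi1 _ sum_phi x x1.
under eq_bigr => i _ do rewrite sqr_hnormB phi1 x1 expr1n.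
rewrite sumrB sumr_const card_ord big_split /= -!raddf_sum /=.
(* With the sums inside the form, both cross terms vanish by [sum_phi]. *)
rewrite -linear_sumlz sum_phi linear0l linear0r raddf0 addr0 subr0.
by rewrite mulr_natr.
Qed.
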